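(* Let $F$ and $E$ be Hausdorff spaces and let $f:F\to E$ be nearly continuous and separating. Suppose $E$ is regular and $m\tau^*$-Baire. Then $f$ is continuous.
   Context: All topological spaces are Hausdorff. $\overline{A}$ denotes closure and $A^\circ$ interior. A mapping $f:F\to E$ is nearly continuous if $f^{-1}(V)\subseteq \left(\overline{f^{-1}(V)}\right)^\circ$ for every open $V\subseteq E$. A mapping $f:F\to E$ is separating if for any $x,y\in E$ with $x\neq y$ there exist neighborhoods $V_x$ of $x$ and $V_y$ of $y$ in $E$ such that $\overline{f^{-1}(V_x)}\cap f^{-1}(V_y)=\emptyset=f^{-1}(V_x)\cap\overline{f^{-1}(V_y)}$. Tandem Michael game on $E$ (players $\beta'$ and $\alpha'$): Player $\beta'$ starts with a nonempty set $B_1\subseteq E$; $\alpha'$ responds with a nonempty relatively open $A_1\subseteq B_1$ (i.e. $A_1=B_1\cap U$ for some open $U\subseteq E$). Then $\beta'$ chooses a nonempty $B_1'\subseteq E$, and $\alpha'$ responds with a nonempty relatively open $A_1'\subseteq B_1'$. Then $\beta'$ chooses a nonempty $B_2\subseteq A_1$, $\alpha'$ responds with a nonempty relatively open $A_2\subseteq B_2$; then $\beta'$ chooses a nonempty $B_2'\subseteq A_1'$, $\alpha'$ responds with a nonempty relatively open $A_2'\subseteq B_2'$; and so on, so that the moves are in the order $B_1,A_1,B_1',A_1',B_2,A_2,B_2',A_2',\dots$ and produce two nested sequences $B_1\supseteq A_1\supseteq B_2\supseteq A_2\supseteq\cdots$ and $B_1'\supseteq A_1'\supseteq B_2'\supseteq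 A_2'\supseteq\cdots$. Players have full information of the past; a strategy for a player is a map assigning to each finite sequence of preceding moves a legal next move. Player $\alpha'$ wins if $\bigcap_n\overline{A_n}\neq\emptyset$ and $\bigcap_n\overline{A_n'}\neq\emptyset$. Player $\alpha'$ wins strongly if every filter $\mathscr F$ with $A_n\in\mathscr F$ for all $n$ has an accumulation (cluster) point in $\bigcap_n\overline{A_n}\neq\emptyset$, and every filter $\mathscr F'$ with $A_n'\in\mathscr F'$ for all $n$ has an accumulation point in $\bigcap_n\overline{A_n'}\neq\emptyset$. $E$ is $m\tau^*$-Baire if for every strategy of player $\beta'$ there exists a strategy of player $\alpha'$ which wins strongly against it. *)

(* Defs.v *)
From HB Require Import structures.
From mathcomp Require Import all_boot all_order all_algebra.
From mathcomp Require Import all_classical topology.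
Set Implicit Arguments.
Unset Strict Implicit.
Unset Printing Implicit Defensive.
Local Open Scope classical_set_scope.

Definition nearly_continuous (F E : topologicalType) (f : F -> E) : Prop :=
  forall V : set E, open V -> f @^-1` V `<=` (closure (f @^-1` V))°.

Definition separating (F E : topologicalType) (f : F -> E) : Prop :=
  forall x y : E, x <> y ->
  exists Vx Vy : set E, [/\ nbhs x Vx, nbhs y Vy,
    closure (f @^-1` Vx) `&` f @^-1` Vy = set0 &
    f @^-1` Vx `&` closure (f @^-1` Vy) = set0].

(* The tandem Michael game.  A position is the list of the moves already made,
   in the order B_1, A_1, B'_1, A'_1, B_2, A_2, B'_2, A'_2, ...; hence the
   player beta' is to move at positions of even size, alpha' at positions of
   odd size. *)
Definition position (E : topologicalType) := seq (set E).

(* At an even position of size k >= 4, the entry of index k - 3 is the latest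
   set chosen by alpha' in the same one of the two nested sequences: A_n when
   beta' has to choose B_{n+1}, and A'_n when beta' has to choose B'_{n+1}. *)
Definition legal_move (E : topologicalType) (p : position E) (M : set E) :
    Prop :=
  M !=set0 /\
  if odd (size p) then exists2 U : set E, open U & M = last set0 p `&` U
  else (4 <= size p)%N -> M `<=` nth set0 p (size p - 3).

Definition legal_position (E : topologicalType) (p : position E) : Prop :=
  forall k, (k < size p)%N -> legal_move (take k p) (nth set0 p k).

(* Values of a strategy outside the legal positions of its owner are
   irrelevant. *)
Definition strategy_beta (E : topologicalType) (s : position E -> set E) :
    Prop :=
  forall p, legal_position p -> ~~ odd (size p) -> legal_move p (s p).

Definition strategy_alpha (E : topologicalType) (t : position E -> set E) :
    Prop :=
  forall p, legal_position p -> odd (size p) -> legal_move p (t p).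

Definition next_move (E : topologicalType) (s t : position E -> set E)
    (p : position E) : set E :=
  if odd (size p) then t p else s p.

Fixpoint play (E : topologicalType) (s t : position E -> set E) (n : nat) :
    position E :=
  if n is m.+1 then
    let p := play s t m in rcons p (next_move s t p)
  else [::].

Definition move (E : topologicalType) (s t : position E -> set E) (n : nat) :
    set E :=
  next_move s t (play s t n).

(* With n counted from 0, these are the sets A_{n+1} and A'_{n+1}. *)
Definition alpha_move (E : topologicalType) (s t : position E -> set E)
  (n : nat) : set E := move s t (4 * n + 1).

Definition alpha_move' (E : topologicalType) (s t : position E -> set E)
  (n : nat) : set E := move s t (4 * n + 3).

(* Filters are proper, as usual; library filters may contain set0. *)
Definition strong_sequence (E : topologicalType) (A : nat -> set E) : Prop :=
  \bigcap_n closure (A n) !=set0 /\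
  forall G : set_system E, ProperFilter G -> (forall n, G (A n)) ->
    cluster G `&` \bigcap_n closure (A n) !=set0.

Definition wins_strongly (E : topologicalType) (s t : position E -> set E) :
    Prop :=
  strong_sequence (alpha_move s t) /\ strong_sequence (alpha_move' s t).

Definition mtaustar_Baire (E : topologicalType) : Prop :=
  forall s : position E -> set E, strategy_beta s ->
  exists2 t : position E -> set E, strategy_alpha t & wins_strongly s t.

(* Main.v *)
Require Import Defs.
From mathcomp Require Import all_boot all_order all_algebra.
From mathcomp Require Import all_classical topology.
Local Open Scope classical_set_scope.

(** Suppose that [f] is not continuous at [x0]: some neighborhood of [f x0]
    has a preimage that is not a neighborhood of [x0].  By regularity it can be
    shrunk to open sets [V] around [f x0] and [W] elsewhere with disjoint
    closures; by near continuity both [f @^-1` V] and [f @^-1` W] are dense in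
    one nonempty open set [O] of [F].

    Player [beta'] then keeps the two preimages mixed up.  Each time [alpha']
    plays a set [A], the region [O] is shrunk to its intersection with the
    interior of the closure of [f @^-1` A]; the next move of [beta'] is the
    image of the current region, cut down to the last set of [alpha'] in the
    sequence where [beta'] has to move ([V] or [W] at the start).  Near
    continuity keeps the region nonempty ([entangled_step]), so in the
    resulting play every [closure (f @^-1` A n)] meets [f @^-1` A' n]
    ([strategy_entangled]), while the [A n] lie in [V] and the [A' n] in [W].

    If [alpha'] wins strongly, this contradicts separation.  Strong winning
    means that the [A n] shrink to the set of their common cluster points as to
    a compact set: a property of sets that is inherited by subsets and finite
    unions, and that holds locally at the cluster points, holds for some [A n]
    ([strong_sequence_ideal]).  Every cluster point of [A] differs from every
    cluster point of [A'], so separation holds locally between them; applying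
    this principle to [A] and then to [A'] separates some [A n] from some
    [A' n] ([separating_strong_sequences]). *)

(** * Strongly winning sequences *)

(** Otherwise the sets whose complement is in the ideal, relative to some
    [A n], form a proper filter that contains every [A n] and has no cluster
    point in the intersection of the closures. *)
Lemma strong_sequence_ideal {E : topologicalType} (A : nat -> set E)
    (I : set (set E)) :
  (forall n m, (n <= m)%N -> A m `<=` A n) ->
  I set0 -> (forall P Q, P `<=` Q -> I Q -> I P) ->
  (forall P Q, I P -> I Q -> I (P `|` Q)) ->
  strong_sequence A ->
  (forall x, (\bigcap_n closure (A n)) x -> exists2 Q, nbhs x Q & I Q) ->
  exists n, I (A n).
Proof.
move=> Adec I0 IS IU [_ Astrong] Iloc; apply: contrapT => noI.
pose G : set_system E := [set P | exists n, I (A n `\` P)].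
have GF : ProperFilter G.
  apply: Build_ProperFilter; first
    by move=> [n]; rewrite setD0 => In; apply: noI; exists n.
  split.
  - by exists 0%N; rewrite setDT.
  - move=> P Q [n InP] [m ImQ]; exists (maxn n m).
    apply: IS (IU _ _ InP ImQ) => z [Az /not_andP[nP|nQ]].
      by left; split=> //; apply: Adec Az; rewrite leq_maxl.
    by right; split=> //; apply: Adec Az; rewrite leq_maxr.
  - move=> P Q PQ [n InP]; exists n; apply: IS InP => z [Az nQ].
    by split=> // /PQ.
have GA n : G (A n) by exists n; rewrite setDv.
have [x [Gx Ax]] := Astrong G GF GA.
have [Q Qx IQ] := Iloc x Ax.
have GQ : G (~` Q) by exists 0%N; apply: IS IQ => z [_ /contrapT].
by have [z []] := Gx _ _ GQ Qx.
Qed.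

(** For a fixed cluster point [y] of [A'], the sets separated from some
    neighborhood of [y] form an ideal that contains a neighborhood of every
    cluster point of [A]; so it contains some [A n].  Thus the sets separated
    from some [A n] form an ideal that contains a neighborhood of every cluster
    point of [A'], and so some [A' n]. *)
Lemma separating_strong_sequences {F E : topologicalType} (f : F -> E)
    (A A' : nat -> set E) :
  separating f ->
  (forall n m, (n <= m)%N -> A m `<=` A n) ->
  (forall n m, (n <= m)%N -> A' m `<=` A' n) ->
  strong_sequence A -> strong_sequence A' ->
  \bigcap_n closure (A n) `&` \bigcap_n closure (A' n) = set0 ->
  exists n, closure (f @^-1` A n) `&` f @^-1` A' n = set0.
Proof.
move=> f_sep Adec A'dec Astr A'str AA'.
have point_sep y : (\bigcap_n closure (A' n)) y ->
    exists n, exists2 Q, nbhs y Q & closure (f @^-1` A n) `&` f @^-1` Q = set0.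
  move=> A'y.
  apply: (@strong_sequence_ideal _ A
    [set P | exists2 Q, nbhs y Q & closure (f @^-1` P) `&` f @^-1` Q = set0]) => //.
  - exists setT; first exact: filterT.
    by rewrite preimage_set0 closure0 set0I.
  - move=> P P' PP' [Q Qy P'Q]; exists Q => //; rewrite -subset0 => z [Pz Qz].
    rewrite -P'Q; split=> //; apply: closureS Pz; exact: preimage_subset.
  - move=> P P' [Q Qy PQ] [Q' Q'y P'Q']; exists (Q `&` Q'); first exact: filterI.
    rewrite preimage_setU closureU; rewrite -subset0 => z [[Pz|Pz] [Qz Q'z]].
      by rewrite -PQ.
    by rewrite -P'Q'.
  - move=> x Ax.
    have xy : x <> y.
      by move=> xy; rewrite xy in Ax; suff : set0 y by []; rewrite -AA'.
    have [Vx [Vy [Vxx Vyy VxVy _]]] := f_sep x y xy.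
    by exists Vx => //; exists Vy.
have [] // := @strong_sequence_ideal _ A'
  [set Q | exists n, closure (f @^-1` A n) `&` f @^-1` Q = set0] A'dec.
- by exists 0%N; rewrite preimage_set0 setI0.
- move=> P P' PP' [n AP']; exists n; rewrite -subset0 => z [Az Pz].
  by rewrite -AP'; split=> //; apply: PP'.
- have clA n m : (n <= m)%N -> closure (f @^-1` A m) `<=` closure (f @^-1` A n).
    by move=> nm; apply: closureS; apply: preimage_subset; apply: Adec.
  move=> P P' [n AP] [m AP']; exists (maxn n m).
  rewrite -subset0 => z [Az [Pz|P'z]].
    by rewrite -AP; split=> //; apply: clA Az; rewrite leq_maxl.
  by rewrite -AP'; split=> //; apply: clA Az; rewrite leq_maxr.
- by move=> y /point_sep[n [Q Qy AQ]]; exists Q => //; exists n.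
move=> m [n AA'0]; exists (maxn n m); rewrite -subset0 => z [Az A'z].
rewrite -AA'0; split.
  by apply: closureS Az; apply: preimage_subset; apply: Adec; rewrite leq_maxl.
by apply: A'dec A'z; rewrite leq_maxr.
Qed.

(** * Regions where two preimages are dense *)

Definition relatively_open_on {F E : topologicalType} (f : F -> E)
    (O : set F) (C : set E) : Prop :=
  exists2 G, open G & f @` O `&` C = f @` O `&` G.

(** The invariant of the play: [O] is the current region, [C] the set in which
    [beta'] has to move next and [C'] the one in which [beta'] moves after
    that.  The sets [C] and [C'] need not be open, but near continuity can be
    applied to the open sets that cut them out of the image of [O]. *)
Definition entangled {F E : topologicalType} (f : F -> E)
    (O : set F) (C C' : set E) : Prop :=
  [/\ open O, O !=set0,
      O `<=` closure (f @^-1` C) /\ O `<=` closure (f @^-1` C'),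
      relatively_open_on f O C & relatively_open_on f O C'].

Lemma relatively_open_onS {F E : topologicalType} {f : F -> E}
    {O O' : set F} {C : set E} :
  O' `<=` O -> relatively_open_on f O C -> relatively_open_on f O' C.
Proof.
move=> O'O [G oG OG]; exists G => //; apply/seteqP; split=> z [O'z Cz];
  (split=> //; have Oz := image_subset f O'O _ O'z).
- by have [] : (f @` O `&` G) z by rewrite -OG.
- by have [] : (f @` O `&` C) z by rewrite OG.
Qed.

Lemma open_dense_meet {F : topologicalType} (O P : set F) :
  open O -> O !=set0 -> O `<=` closure P -> O `&` P !=set0.
Proof.
move=> oO [z Oz] OP; have [|w [Pw Ow]] := OP z Oz O; last by exists w.
exact: open_nbhs_nbhs.
Qed.

Lemma entangled_image_neq0 {F E : topologicalType} (f : F -> E)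
    (O : set F) (C C' : set E) :
  entangled f O C C' -> f @` O `&` C !=set0.
Proof.
move=> [oO O0 [OC _] _ _]; have [z [Oz Cz]] := open_dense_meet _ _ oO O0 OC.
by exists (f z); split=> //; exists z.
Qed.

(** The preimage of [A] only contains [O `&` f @^-1` (G `&` U)] for some open
    [G], but this set is dense in the part of [O] inside the interior of the
    closure of [f @^-1` (G `&` U)].  By near continuity that part contains any
    point of [O] mapped into [A], so the new region is nonempty. *)
Lemma entangled_step {F E : topologicalType} (f : F -> E)
    (O : set F) (C C' U A : set E) :
  nearly_continuous f -> entangled f O C C' -> open U ->
  A = f @` O `&` C `&` U -> A !=set0 ->
  entangled f (O `&` (closure (f @^-1` A))°) C' A.
Proof.
move=> f_nearly [oO _ [OC OC'] [G oG OG] rC'] oU defA A0.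
have {}defA : A = f @` O `&` (G `&` U) by rewrite defA OG setIA.
have O'O : O `&` (closure (f @^-1` A))° `<=` O by apply: subIsetl.
split.
- exact: openI oO (open_interior _).
- case: A0 => y; rewrite defA => -[[z Oz <-] GUz]; exists z; split=> //.
  pose N := O `&` (closure (f @^-1` (G `&` U)))°.
  have oN : open N by apply: openI oO (open_interior _).
  have Nz : N z by split=> //; apply: f_nearly GUz; apply: openI.
  apply: (@filterS _ (nbhs z) _ N); last exact: open_nbhs_nbhs.
  move=> w Nw B Bw; have [_ /interior_subset GUw] := Nw.
  have [|v [GUv [[Ov _] Bv]]] := GUw (N `&` B).
    by apply: filterI Bw; apply: open_nbhs_nbhs.
  by exists v; split=> //; split=> //; exists v.
- split; first by move=> z /O'O /OC'.
  by move=> z [_ /interior_subset].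
- exact: relatively_open_onS rC'.
- apply: (relatively_open_onS O'O); exists (G `&` U); first exact: openI.
  by rewrite defA setIA setIid.
Qed.

(** * Plays of the tandem game *)

Section Play.
Context {E : topologicalType} (s t : position E -> set E).

Lemma size_play n : size (play s t n) = n.
Proof. by elim: n => //= n IH; rewrite size_rcons IH. Qed.

Lemma nth_play n i : (i < n)%N -> nth set0 (play s t n) i = move s t i.
Proof.
elim: n => //= n IH; rewrite ltnS leq_eqVlt nth_rcons size_play.
by case: ltngtP => //= [/IH|-> _].
Qed.

Lemma take_play n k : (k <= n)%N -> take k (play s t n) = play s t k.
Proof.
elim: n => [|n IH]; first by rewrite leqn0 => /eqP ->.
rewrite leq_eqVlt => /orP[/eqP ->|]; first by rewrite -{1}(size_play n.+1) take_size.
by rewrite ltnS => kn /=; rewrite -cats1 takel_cat ?size_play// IH.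
Qed.

Hypotheses (s_beta : strategy_beta s) (t_alpha : strategy_alpha t).

Lemma legal_play n : legal_position (play s t n).
Proof.
elim: n => [//|n IH] k; rewrite size_play => kn.
rewrite nth_play// take_play; last exact: ltnW.
have {IH} IHk : legal_position (play s t k).
  move=> j; rewrite size_play => jk.
  have jn : (j < n)%N by apply: leq_trans jk _; rewrite -ltnS.
  have := IH j; rewrite size_play !nth_play//.
  by rewrite !take_play ?(ltnW jk) ?(ltnW jn)//; apply.
rewrite /move /next_move; case: ifPn => op; first exact: t_alpha.
exact: s_beta.
Qed.

Lemma legal_move_play n : legal_move (play s t n) (move s t n).
Proof.
have := legal_play n.+1 n; rewrite size_play => /(_ (ltnSn n)).
by rewrite nth_play// take_play.
Qed.

Lemma move_odd_open n : odd n ->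
  exists2 U, open U & move s t n = move s t n.-1 `&` U.
Proof.
case: n => // n on; have [_] := legal_move_play n.+1.
by rewrite size_play on /= last_rcons.
Qed.

End Play.

(** * The strategy of beta' *)

Section Strategy.
Context {F E : topologicalType} (f : F -> E) (O : set F) (V W : set E).

(** At a position of size [0], [2], or [k >= 4], this is [V], [W], or the
    entry of index [k - 3], which is the last set that [alpha'] chose in the
    sequence where [beta'] has to move: the entry [setT] of index [1] is never
    used. *)
Definition target (p : position E) : set E :=
  nth set0 [:: V, setT, W & p] (size p).

(** All moves are used, although only those of [alpha'] matter: the preceding
    move of [beta'] is a larger set. *)
Definition region (p : position E) : set F :=
  foldl (fun R M => R `&` (closure (f @^-1` M))°) O p.

(** At legal positions that this strategy never leads to, the first set may be
    empty. *)
Definition entangling (p : position E) : set E :=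
  let M := f @` region p `&` target p in
  if `[< M !=set0 >] then M else target p.

Lemma entangling_strategy : V !=set0 -> W !=set0 -> strategy_beta entangling.
Proof.
move=> V0 W0 p lp ep.
have tp : target p !=set0.
  case: p lp ep => [|a [|b [|c p]]] //= lp _.
  rewrite /target /=.
  have [|] := lp (size p); last by [].
  by rewrite /= ltnS; apply: leq_trans (leqnSn _); apply: leqnSn.
split; first by rewrite /entangling; case: asboolP.
rewrite (negbTE ep) => p4 z.
suff -> : nth set0 p (size p - 3) = target p.
  by rewrite /entangling; case: asboolP => // _ [].
by rewrite /target; case: (size p) p4 => [|[|[|[|k]]]] //= _; rewrite subSS.
Qed.

Variable t : position E -> set E.
Hypotheses (V0 : V !=set0) (W0 : W !=set0) (t_alpha : strategy_alpha t).
Hypotheses (f_nearly : nearly_continuous f) (OVW : entangled f O V W).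

(** The two sequences of [alpha'] merged in the order of play, and preceded by
    [V] and [W] in the role of initial moves. *)
Definition merged (k : nat) : set E :=
  if k is k'.+2 then move entangling t k'.*2.+1
  else if k is 0 then V else W.

Lemma target_play k : target (play entangling t k.*2) = merged k.
Proof.
rewrite /target size_play; case: k => [|[|k]] //.
rewrite [LHS](_ : _ = nth set0 (play entangling t k.+2.*2) k.*2.+1) //.
by rewrite nth_play// !doubleS -addn4 -addn1 ltn_add2l.
Qed.

Let st : strategy_beta entangling := entangling_strategy V0 W0.

Lemma merged_step k :
  entangled f (region (play entangling t k.*2)) (merged k) (merged k.+1) ->
  [/\ exists2 U, open U & merged k.+2 =
        f @` region (play entangling t k.*2) `&` merged k `&` U,
      merged k.+2 !=set0 &
      region (play entangling t k.+1.*2) =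
        region (play entangling t k.*2) `&` (closure (f @^-1` merged k.+2))°].
Proof.
move=> ent.
have moveB : move entangling t k.*2 =
    f @` region (play entangling t k.*2) `&` merged k.
  rewrite /move /next_move size_play odd_double /entangling target_play.
  by case: asboolP => // /(_ (entangled_image_neq0 _ _ _ _ ent)).
have [|U oU] := move_odd_open _ _ st t_alpha k.*2.+1; first by rewrite /= odd_double.
rewrite [k.*2.+1.-1]/= => moveA.
split.
- by exists U => //; rewrite -moveB.
- by have [] := legal_move_play _ _ st t_alpha k.*2.+1.
- rewrite doubleS -[play _ _ k.*2.+2]/(rcons (rcons (play entangling t k.*2)
    (move entangling t k.*2)) (merged k.+2)) /region !foldl_rcons -/(region _).
  rewrite -setIA; congr (_ `&` _); apply: setIidr.
  apply: interiorS; apply: closureS; apply: preimage_subset.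
  by rewrite [merged k.+2]/= moveA; apply: subIsetl.
Qed.

Lemma entangled_play k :
  entangled f (region (play entangling t k.*2)) (merged k) (merged k.+1).
Proof.
elim: k => // k IH; have [[U oU defA] A0 ->] := merged_step k IH.
exact: entangled_step f_nearly IH oU defA A0.
Qed.

Lemma merged_subset k j : merged (k + j.*2) `<=` merged k.
Proof.
elim: j => [|j IH]; first by rewrite addn0.
rewrite doubleS !addnS; apply: subset_trans IH.
have [[U oU ->] _ _] := merged_step _ (entangled_play (k + j.*2)).
by move=> z [[]].
Qed.

Lemma alpha_move_merged n : alpha_move entangling t n = merged n.+1.*2.
Proof. by rewrite /alpha_move doubleS /= -!mul2n mulnA addn1. Qed.

Lemma alpha_move'_merged n : alpha_move' entangling t n = merged n.+1.*2.+1.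
Proof. by rewrite /alpha_move' doubleS /= doubleS -!mul2n mulnA addn3. Qed.

(** The region after [A' n] lies in both closures, and being open and nonempty
    it contains a point of the preimage of [A' n] itself. *)
Lemma strategy_entangled :
  [/\ forall n m, (n <= m)%N ->
        alpha_move entangling t m `<=` alpha_move entangling t n,
      forall n m, (n <= m)%N ->
        alpha_move' entangling t m `<=` alpha_move' entangling t n,
      alpha_move entangling t 0 `<=` V, alpha_move' entangling t 0 `<=` W &
      forall n, closure (f @^-1` alpha_move entangling t n) `&`
        f @^-1` alpha_move' entangling t n !=set0].
Proof.
split.
- move=> n m nm; rewrite !alpha_move_merged.
  by rewrite -(subnKC nm) -addSn doubleD; apply: merged_subset.
- move=> n m nm; rewrite !alpha_move'_merged.
  by rewrite -(subnKC nm) -addSn doubleD -addSn; apply: merged_subset.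
- by rewrite alpha_move_merged; apply: (merged_subset 0 1).
- by rewrite alpha_move'_merged; apply: (merged_subset 1 1).
- move=> n; rewrite alpha_move_merged alpha_move'_merged.
  have [oR R0 [RC RC'] _ _] := entangled_play n.+1.*2.
  have [z [/RC Az A'z]] := open_dense_meet _ _ oR R0 RC'.
  by exists z.
Qed.

End Strategy.

(** * Continuity *)

(** Disjointness of [V] and [W] would not suffice: the sets of [alpha'] have
    their cluster points in the closures.  Hence regularity is used twice, to
    place the closure of [V] inside the interior of a neighborhood [N1] whose
    closure has [W] as its complement. *)
Lemma discontinuity_entangled {F E : topologicalType} (f : F -> E) :
  regular_space E -> nearly_continuous f -> ~ continuous f ->
  exists O V W, [/\ entangled f O V W, V !=set0, W !=set0 &
    closure V `&` closure W = set0].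
Proof.
move=> E_regular f_nearly /existsNP[x0 /existsNP[U /not_implyP[fx0U nU]]].
have [N1 fx0N1 N1U] := E_regular (f x0) U fx0U.
have fx0N1o : nbhs (f x0) N1° by apply: nbhs_interior.
have [N2 fx0N2 N2N1] := E_regular (f x0) _ fx0N1o.
pose V := N2°; pose W := ~` closure N1.
have oV : open V by apply: open_interior.
have oW : open W by apply: closed_openC; apply: closed_closure.
have [x1 Vx1 Wx1] : exists2 x1, (closure (f @^-1` V))° x1 & W (f x1).
  apply: contrapT => noW; apply: nU.
  apply: (@filterS _ (nbhs x0) _ (closure (f @^-1` V))°).
    move=> z Vz; apply: N1U; apply: contrapT => Wz; apply: noW.
    by exists z.
  apply: open_nbhs_nbhs; split; first exact: open_interior.
  by apply: f_nearly => //; apply: nbhs_singleton; apply: nbhs_interior.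
have V0 : V !=set0.
  by exists (f x0); apply: nbhs_singleton; apply: nbhs_interior.
exists ((closure (f @^-1` V))° `&` (closure (f @^-1` W))°), V, W.
split=> //; last 2 first.
- by exists (f x1).
- rewrite -subset0 => z [Vz Wz].
  have N1z : N1° z.
    by apply: N2N1; apply: closureS Vz; apply: interior_subset.
  have [w [Ww N1w]] := Wz _ N1z.
  by apply: Ww; apply: subset_closure.
split.
- by apply: openI; apply: open_interior.
- by exists x1; split=> //; apply: f_nearly.
- by split=> z [Vz Wz]; apply: interior_subset.
- by exists V.
- by exists W.
Qed.

Theorem theorem1 (F E : topologicalType) (f : F -> E)
  (hF : hausdorff_space F) (hE : hausdorff_space E)
  (f_nearly : nearly_continuous f) (f_sep : separating f)
  (E_regular : regular_space E) (E_Baire : mtaustar_Baire E) :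
  continuous f.
Proof.
apply: contrapT => ncf.
have [O [V [W [OVW V0 W0 VW]]]] := discontinuity_entangled _ E_regular f_nearly ncf.
have [t t_alpha [Astr A'str]] := E_Baire _ (entangling_strategy f O V W V0 W0).
have [Adec A'dec AV A'W AA'] :=
  strategy_entangled _ _ _ _ _ V0 W0 t_alpha f_nearly OVW.
have [|n] := separating_strong_sequences _ _ _ f_sep Adec A'dec Astr A'str.
  rewrite -subset0 => z [Az A'z]; rewrite -VW.
  split; first exact: closureS AV _ (Az 0%N I).
  exact: closureS A'W _ (A'z 0%N I).
by have /set0P/eqP := AA' n.
Qed.
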